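(* Let $Q$ be a finite van Rees loop and let $S$ be a subloop of $Q$ of index $3$, i.e. $|Q|=3|S|$. Then $S$ is normal in $Q$.
   Context: A loop is a set with a binary operation whose left translations $y\mapsto xy$ and right translations $y\mapsto yx$ are all bijections and which has a two-sided neutral element $\varepsilon$. Loops (more generally quasigroups) $(Q,\cdot)$ and $(P,\circ)$ are isotopic if there are bijections $\alpha,\beta,\gamma:Q\to P$ with $\alpha(x)\circ\beta(y)=\gamma(x\cdot y)$ for all $x,y$. A loop has exponent $3$ if it satisfies $xx\cdot x=x\cdot xx=\varepsilon$ for all $x$. A van Rees loop is a loop $Q$ such that every loop isotopic to $Q$ has exponent $3$. A subloop $S$ of $Q$ is normal if it is the kernel of a loop homomorphism from $Q$, equivalently $xS=Sx$, $x(yS)=(xy)S$ and $(Sx)y=S(xy)$ for all $x,y\in Q$. *)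

(* Defs.v *)
From HB Require Import structures.
From mathcomp Require Import all_boot.

Set Implicit Arguments.
Unset Strict Implicit.
Unset Printing Implicit Defensive.

Local Open Scope group_scope.

HB.mixin Record UMagma_isLoop G of UMagma G := {
  ltrans_bij : forall x : G, bijective (fun y : G => x * y);
  rtrans_bij : forall x : G, bijective (fun y : G => y * x)
}.

#[short(type="loopType")]
HB.structure Definition Loop := { G of UMagma_isLoop G & UMagma G }.

#[short(type="finLoopType")]
HB.structure Definition FinLoop := { G of Loop G & Finite G }.

Definition isotopic (G H : magmaType) : Prop :=
  exists alpha beta gamma : G -> H,
    [/\ bijective alpha, bijective beta, bijective gamma
      & forall x y : G, alpha x * beta y = gamma (x * y)].

Definition has_exponent3 (G : loopType) : Prop :=
  forall x : G, (x * x) * x = 1 /\ x * (x * x) = 1.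

(* The [choiceType] structure carried by [P : loopType] is no restriction:
   it can be transported from [Q] along the bijections of an isotopy. *)
Definition van_rees (Q : loopType) : Prop :=
  forall P : loopType, isotopic Q P -> has_exponent3 P.

(* Closure under multiplication and under both divisions: the quotient
   [x \ z] is the [y] such that [x * y = z], and symmetrically. *)
Definition subloop (Q : loopType) (S : {pred Q}) : Prop :=
  [/\ umagma_closed S,
      forall x y : Q, x \in S -> x * y \in S -> y \in S
    & forall x y : Q, x \in S -> y * x \in S -> y \in S].

(* A multiplicative map between loops preserves the neutral element, by
   cancellation, so [{multiplicative Q -> P}] is the type of loop
   homomorphisms. *)
Definition normal_subloop (Q : loopType) (S : {pred Q}) : Prop :=
  subloop S /\
  exists (P : loopType) (f : {multiplicative Q -> P}),
    forall x : Q, (x \in S) = (f x == 1).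

(* Main.v *)
Require Import Defs.
From HB Require Import structures.
From mathcomp Require Import all_boot.
From mathcomp Require Import fingroup zmodp.

(** For a in S and x outside S put T = L_a^-1 L_x.  Exponent 3 of the isotopes
    says T^3 = 1, and T moves S off itself, so S, T S and T^-1 S are pairwise
    disjoint and fill Q.  As T^-1 S = L_x^-1 S does not depend on a, neither
    does T S = L_a^-1 (x S); hence a (x S) = x S for all a in S, and by
    counting S y = x S = y S for every y in x S.  The two cosets other than S
    multiply with S as the elements of Z_3. *)

Set Implicit Arguments.
Unset Strict Implicit.
Unset Printing Implicit Defensive.

Local Open Scope group_scope.

Section Divisions.
Variable Q : finLoopType.
Implicit Types a b x y : Q.

Lemma lmul_inj x : injective (fun y : Q => x * y).
Proof. exact: bij_inj (ltrans_bij x). Qed.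

Lemma rmul_inj x : injective (fun y : Q => y * x).
Proof. exact: bij_inj (rtrans_bij x). Qed.

Definition ldiv a : Q -> Q := invF (@lmul_inj a).
Definition rdiv x b : Q := invF (@rmul_inj b) x.

Lemma mul_ldiv a y : a * ldiv a y = y.
Proof. exact: (f_invF (@lmul_inj a)). Qed.

Lemma ldiv_mul a y : ldiv a (a * y) = y.
Proof. exact: (invF_f (@lmul_inj a)). Qed.

Lemma rdiv_mul b x : rdiv x b * b = x.
Proof. exact: (f_invF (@rmul_inj b)). Qed.

Lemma mul_rdiv b x : rdiv (x * b) b = x.
Proof. exact: (invF_f (@rmul_inj b)). Qed.

End Divisions.

(** An alias of [Q] carrying [a] and [b] in its type, so that it can receive a loop structure
    different from that of [Q]. *)
Definition isotope (Q : finLoopType) (a b : Q) : Type := Q.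

Section Isotope.
Variables (Q : finLoopType) (a b : Q).

(** The principal isotope: the product sending the pair [x * b], [a * y] to [x * y]. *)
Definition isotope_mul (x y : Q) : Q := rdiv x b * ldiv a y.

Lemma isotope_1mul : left_id (a * b) isotope_mul.
Proof. by move=> y; rewrite /isotope_mul mul_rdiv mul_ldiv. Qed.

Lemma isotope_mul1 : right_id (a * b) isotope_mul.
Proof. by move=> x; rewrite /isotope_mul ldiv_mul rdiv_mul. Qed.

Lemma isotope_ltrans_bij x : bijective (fun y => isotope_mul x y).
Proof.
exists (fun z => a * ldiv (rdiv x b) z) => y; rewrite /isotope_mul.
  by rewrite ldiv_mul mul_ldiv.
by rewrite ldiv_mul mul_ldiv.
Qed.

Lemma isotope_rtrans_bij x : bijective (fun y => isotope_mul y x).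
Proof.
exists (fun z => rdiv z (ldiv a x) * b) => y; rewrite /isotope_mul.
  by rewrite mul_rdiv rdiv_mul.
by rewrite mul_rdiv rdiv_mul.
Qed.

HB.instance Definition _ := Choice.copy (isotope a b) Q.
HB.instance Definition _ := hasMul.Build (isotope a b) isotope_mul.
HB.instance Definition _ :=
  Magma_isUMagma.Build (isotope a b) isotope_1mul isotope_mul1.
HB.instance Definition _ :=
  UMagma_isLoop.Build (isotope a b) isotope_ltrans_bij isotope_rtrans_bij.

Lemma isotopic_isotope : isotopic Q (isotope a b).
Proof.
exists (fun x : Q => (x * b : Q)), (fun y : Q => (a * y : Q)), id; split.
- exact: (rtrans_bij (b : Q)).
- exact: (ltrans_bij (a : Q)).
- by exists id.
- by move=> x y; rewrite [LHS]/(isotope_mul _ _) /isotope_mul mul_rdiv ldiv_mul.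
Qed.

End Isotope.

(** In [isotope a b], left multiplication by [x * b] is [z |-> x * ldiv a z] and the unit is
    [a * b]. That the cube of [x * b] is this unit is T^3 = 1 evaluated at [b]. *)
Lemma van_rees_ldiv_mul3 (Q : finLoopType) (a x : Q) : van_rees Q ->
  forall b, ldiv a (x * ldiv a (x * ldiv a (x * b))) = b.
Proof.
move=> vrQ b; have [_] := vrQ _ (isotopic_isotope a b) (x * b).
rewrite [LHS]/(isotope_mul _ _ _ (isotope_mul _ _ _ _)) /isotope_mul mul_rdiv.
by move=> ->; exact: ldiv_mul.
Qed.

Lemma disjoint3_cover (T : finType) (A B C : {set T}) m :
  #|T| = (3 * m)%N -> #|A| = m -> #|B| = m -> #|C| = m ->
  [disjoint A & B] -> [disjoint A & C] -> [disjoint B & C] ->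
  forall z, z \notin A -> (z \in B) = (z \notin C).
Proof.
move=> cT cA cB cC dAB dAC dBC z zA.
have cAC : #|A :|: C| = (m + m)%N.
  by rewrite cardsU disjoint_setI0 // cards0 cA cC subn0.
have -> : B = ~: (A :|: C).
  apply/eqP; rewrite eqEcard [#|~: _|]cardsCs setCK cT cAC cB.
  rewrite !mulSn mul0n addn0 addnK leqnn andbT.
  by rewrite subsetC subUset -!disjoints_subset dAB disjoint_sym.
by rewrite !inE negb_or zA.
Qed.

Section IndexThree.
Variables (Q : finLoopType) (S : {set Q}).
Hypotheses (vrQ : van_rees Q) (subS : subloop S) (indS : #|Q| = (3 * #|S|)%N).
Implicit Types a s x y z : Q.

Definition coset x : {set Q} := [set x * s | s in S].

Lemma subloop1 : 1 \in S.
Proof. by case: subS => [[]]. Qed.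

Lemma subloop_mull a y : a \in S -> (a * y \in S) = (y \in S).
Proof.
case: subS => [[_ mulS] ldivS _] Sa.
by apply/idP/idP => [/(ldivS _ _ Sa)|/(mulS _ _ Sa)].
Qed.

Lemma subloop_mulr a y : a \in S -> (y * a \in S) = (y \in S).
Proof.
case: subS => [[_ mulS] _ rdivS] Sa.
by apply/idP/idP => [/(rdivS _ _ Sa)|/mulS->].
Qed.

Lemma subloop_ldiv a y : a \in S -> (ldiv a y \in S) = (y \in S).
Proof. by move=> Sa; rewrite -(subloop_mull _ Sa) mul_ldiv. Qed.

Lemma mem_coset x z : (x * z \in coset x) = (z \in S).
Proof. exact: mem_imset (@lmul_inj Q x). Qed.

Lemma coset_refl x : x \in coset x.
Proof. by rewrite -{1}[x]mulg1 mem_coset subloop1. Qed.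

Lemma card_coset x : #|coset x| = #|S|.
Proof. exact: card_imset (@lmul_inj Q x). Qed.

Lemma coset_notin x y : x \notin S -> y \in coset x -> y \notin S.
Proof. by move=> Sx /imsetP[s Ss ->]; rewrite subloop_mulr. Qed.

Lemma mulS_mem_coset a x z : a \in S -> x \notin S -> z \notin S ->
  (a * z \in coset x) = (x * z \notin S).
Proof.
(* [A] is T S and [B] below is T^-1 S, since L_a maps [S] onto itself. *)
move=> Sa Sx Sz; pose A := [set ldiv a y | y in coset x].
pose B := [set ldiv x y | y in S].
have injl y : injective (ldiv y) := can_inj (@mul_ldiv Q y).
have inA y : (y \in A) = (a * y \in coset x).
  by rewrite -{1}(ldiv_mul a y) mem_imset.
have inB y : (y \in B) = (x * y \in S).
  by rewrite -{1}(ldiv_mul x y) mem_imset.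
rewrite -inA -inB; apply: (disjoint3_cover indS) Sz => //.
- by rewrite card_imset ?card_coset.
- by rewrite card_imset.
- rewrite disjoints_subset; apply/subsetP => y Sy; rewrite inE inA.
  by apply/negP => /(coset_notin Sx); rewrite subloop_mull ?Sy.
- rewrite disjoints_subset; apply/subsetP => y Sy.
  by rewrite inE inB subloop_mulr.
(* If T s also lay in T^-1 S, then T^2 s would be in [S] and T^3 s outside it, against T^3 s = s. *)
rewrite disjoints_subset; apply/subsetP => _ /imsetP[_ /imsetP[s Ss ->] ->].
rewrite inE inB; apply/negP => Sxt.
have := van_rees_ldiv_mul3 a x vrQ s; move/(congr1 (fun y => y \in S)).
by rewrite subloop_ldiv // subloop_mulr ?subloop_ldiv // Ss (negPf Sx).
Qed.

Lemma mem_cosetE x z : x \notin S -> z \notin S ->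
  (z \in coset x) = (x * z \notin S).
Proof.
by move=> Sx Sz; rewrite -(mulS_mem_coset subloop1) ?mul1g.
Qed.

(** The criterion in [mulS_mem_coset] does not involve [a], so it can be compared with its case
    [a = 1]. *)
Lemma coset_mulS x a z : x \notin S -> z \notin S -> a \in S ->
  (a * z \in coset x) = (z \in coset x).
Proof. by move=> Sx Sz Sa; rewrite mulS_mem_coset // mem_cosetE. Qed.

(** For [z] outside [S], if [coset z] contains [y] then it contains S y, which has the same size.
    Both [z = x] and [z = y] qualify. *)
Lemma coset_eq x y : x \notin S -> y \in coset x -> coset y = coset x.
Proof.
move=> Sx xy; have Sy := coset_notin Sx xy.
have cardSy : #|[set a * y | a in S]| = #|S|.
  exact: card_imset (@rmul_inj Q y).
have rcosetE z : z \notin S -> y \in coset z ->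
    [set a * y | a in S] = coset z.
  move=> Sz zy; apply/eqP; rewrite eqEcard cardSy card_coset leqnn andbT.
  by apply/subsetP => _ /imsetP[a Sa ->]; rewrite coset_mulS.
by rewrite -(rcosetE y) ?coset_refl // (rcosetE x).
Qed.

(** Cosets of outside elements that meet coincide, so [coset x] is either [coset w] or the
    complement of [S] and [coset w]. *)
Lemma coset_trans w x z : w \notin S -> x \notin S -> z \notin S ->
  (z \in coset x) = ((z \in coset w) == (x \in coset w)).
Proof.
move=> Sw Sx Sz; have [wx|wx] := boolP (x \in coset w).
  by rewrite (coset_eq Sw wx) eqb_id.
rewrite eqbF_neg; have dwS y : y \notin S -> [disjoint S & coset y].
  move=> Sy; rewrite disjoint_sym disjoints_subset; apply/subsetP => t.
  move/coset_notin; by rewrite inE; apply.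
apply: (disjoint3_cover indS _ _ _ _ _ _ Sz); rewrite ?card_coset ?dwS //.
rewrite disjoints_subset; apply/subsetP => t xt; rewrite inE; apply/negP => wt.
by rewrite -(coset_eq Sw wt) (coset_eq Sx xt) coset_refl in wx.
Qed.

Lemma exists_notin_subloop : exists w, w \notin S.
Proof.
apply/existsP; rewrite -negb_forall; apply/negP => /forallP allS.
have /eqP := indS; rewrite (eq_card (allS : S =i Q)) -{1}[#|Q|]mul1n eqn_mul2r.
by rewrite orbF => /eqP/card0_eq/(_ 1).
Qed.

End IndexThree.

(** The product on ['I_3] is addition modulo 3, with unit 0. *)
HB.instance Definition _ :=
  UMagma_isLoop.Build 'I_3
    (fun x => Bijective (mulKg x) (mulKVg x))
    (fun x => Bijective (mulgK x) (mulgKV x)).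

Definition coset_class (Q : finLoopType) (S : {set Q}) (w x : Q) : 'I_3 :=
  if x \in S then inord 0 else if x \in coset S w then inord 1 else inord 2.

Lemma coset_classM (Q : finLoopType) (S : {set Q}) (w : Q) :
  van_rees Q -> subloop S -> #|Q| = (3 * #|S|)%N -> w \notin S ->
  {morph coset_class S w : x y / x * y >-> x * y}.
Proof.
move=> vrQ subS indS Sw x y.
have trans := coset_trans vrQ subS indS Sw.
rewrite /coset_class.
have [Sx|Sx] := boolP (x \in S); have [Sy|Sy] := boolP (y \in S).
- rewrite (subloop_mull subS) // Sy; apply: val_inj; by rewrite /= !inordK.
- rewrite (subloop_mull subS) // (negPf Sy) (coset_mulS vrQ) //.
  by case: ifP => _; apply: val_inj; rewrite /= !inordK.
- have Sxy : x * y \notin S by rewrite (subloop_mulr subS).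
  have := trans x (x * y) Sx Sxy; rewrite mem_coset Sy (negPf Sxy).
  move/esym/eqP => ->.
  by case: ifP => _; apply: val_inj; rewrite /= !inordK.
(* For [x] and [y] outside [S], the product is in [S] exactly when their classes differ: 1 + 2 =
   0. *)
have := trans x y Sx Sy; rewrite (mem_cosetE vrQ) //.
case: ifPn => Sxy /=.
  by case: (y \in _); case: (x \in _) => // _; apply: val_inj; rewrite /= !inordK.
(* The classes now agree, and [x * y] avoids [coset x] because [y] is not in [S]: 1 + 1 = 2 and 2 +
   2 = 1. *)
have := trans x (x * y) Sx Sxy; rewrite mem_coset (negPf Sy).
by case: (x * y \in _); case: (y \in _); case: (x \in _) => // _ _;
  apply: val_inj; rewrite /= !inordK.
Qed.

Theorem theorem6 (Q : finLoopType) (S : {set Q}) :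
  van_rees Q -> subloop S -> #|Q| = (3 * #|S|)%N -> normal_subloop S.
Proof.
move=> vrQ subS indS; split=> //.
have [w Sw] := exists_notin_subloop indS.
have fM := isMultiplicative.Build _ _ _ (coset_classM vrQ subS indS Sw).
pose f : {multiplicative Q -> 'I_3} := HB.pack (coset_class S w) fM.
exists ('I_3 : loopType), f => x; rewrite [f x]/(coset_class S w x) /coset_class.
by case: ifP => // _; [apply/esym/eqP/val_inj | case: ifP => _];
  rewrite -?val_eqE /= ?inordK.
Qed.
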